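(* Fix an integer $k \ge 0$ and a real number $0 < \epsilon < 1$, and let $\omega = \omega(n)$ be a function with $\omega(n) \to \infty$ as $n \to \infty$. For $n > k+1$ let $p = p(n) \in [0,1]$ satisfy $$p \ge \frac{(k+2)(k+1)\log n + \omega}{\epsilon^2 (n-k-1)},$$ and let $V = V_{n,p}$ be a random $p$-subcomplex of the $n$-dimensional cross-polytope $\widehat{Q}_n$, where $(k+1)$-dimensional faces are chosen independently with probability $p$. Then asymptotically almost surely (with probability tending to $1$ as $n\to\infty$) $$h^k(V) \ge \frac{2(1-\epsilon)(n-k-1)p}{k+2}.$$ Moreover, the maximum $k$-degree $D_k(V)$ is a.a.s. of order $np$: there are constants $C_1, C_2 > 0$ depending only on $k$ and $\epsilon$ such that a.a.s. $C_1 np \le D_k(V) \le C_2 np$. Consequently $V$ is a.a.s. a degree-relative $k$-coboundary expander: there is a constant $c = c(k,\epsilon) > 0$ such that a.a.s. $\frac{h^k(V)}{D_k(V)} \ge c$.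
   Context: $\widehat{Q}_n$ denotes the $n$-dimensional cross-polytope, viewed as a simplicial complex via its proper faces: it has $2n$ vertices $\pm e_1, \dots, \pm e_n$, and a set of vertices spans a face iff it contains no antipodal pair $\{e_i,-e_i\}$; thus it has $\binom{n}{k+1}2^{k+1}$ faces of dimension $k$. A random $p$-subcomplex $V_{n,p}$ contains all faces of $\widehat{Q}_n$ of dimension at most $k$, no faces of dimension greater than $k+1$, and each $(k+1)$-dimensional face of $\widehat{Q}_n$ is included independently with probability $p$. For a finite simplicial complex $X$, $X^{(k)}$ denotes the set of $k$-dimensional faces and $C^kX = \{X^{(k)} \to \mathbb{Z}_2\}$ the $\mathbb{Z}_2$-vector space of $k$-cochains. The coboundary $d : C^kX \to C^{k+1}X$ is $d\beta(x) = \sum_{y \in \partial x}\beta(y)$, the sum being over the $k$-faces $y$ in the boundary of the $(k+1)$-face $x$. The reduced (augmented) cochain complex is used: $C^{-1}X = \mathbb{Z}_2$, and $d : C^{-1}X \to C^0X$ sends $1$ to the constant function $1$. Write $B^kX = d(C^{k-1}X)$. The norm $\|\beta\|$ of a cochain is the cardinality of its support, and $\|[\beta]\| = \min_{\alpha \in C^{k-1}X}\|\beta + d\alpha\|$. The $k$th coboundary expansion is $$h^k(X) = \min_{\beta \in C^kX \setminus B^kX} \frac{\|d\beta\|}{\|[\beta]\|}.$$ The maximum $k$-degree $D_k(X)$ is the maximum, over $k$-faces of $X$, of the number of $(k+1)$-faces of $X$ containing that $k$-face. *)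

(* Defs.v *)
From HB Require Import structures.
From mathcomp Require Import all_boot all_order all_algebra.
From mathcomp Require Import boolp classical_sets reals topology normedtype
  sequences exp.
(* The finite-set names come last: [set0] is the empty finite set. *)
From mathcomp Require Import fintype finset.

Set Implicit Arguments.
Unset Strict Implicit.
Unset Printing Implicit Defensive.

Import Order.TTheory GRing.Theory Num.Theory numFieldNormedType.Exports.

Local Open Scope ring_scope.

(** A finite complex on a vertex type [T] is its set of faces, the empty face
    included.  Faces are graded by their number of vertices rather than by
    their dimension, which gives room for dimension -1: [faces X k.+1] is
    X^(k), and [cochain X k.+1] is C^k X.  In particular [cochain X 0], the
    functions on the empty face, is C^{-1} X = Z_2, and [coboundary] on it is
    the augmentation, so the cochain complex is the reduced one. *)

Section Complex.
Variable T : finType.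
Implicit Types X : {set {set T}}.

Definition simplicial_complex X : Prop :=
  set0 \in X /\
  forall s t : {set T}, s \in X -> t \subset s -> t \in X.

Definition faces X (m : nat) : {set {set T}} := [set s in X | #|s| == m].

Definition cochain X (m : nat) : Type :=
  {ffun {s : {set T} | s \in faces X m} -> 'F_2}.

HB.instance Definition _ X m := GRing.Zmodule.on (cochain X m).
HB.instance Definition _ X m := Finite.on (cochain X m).

Definition coboundary X m (b : cochain X m) : cochain X m.+1 :=
  [ffun x : {s : {set T} | s \in faces X m.+1} =>
     \sum_(y : {s : {set T} | s \in faces X m} | val y \subset val x) b y].

(* B^k X is [coboundaries X k], a subset of C^k X = [cochain X k.+1]. *)
Definition coboundaries X k : {set cochain X k.+1} :=
  [set coboundary a | a : cochain X k].

Definition norm X m (b : cochain X m) : nat :=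
  #|[set s : {s : {set T} | s \in faces X m} | b s != 0]|.

(* The default value [norm b] is the term of index [a = 0], so that this is
   the minimum over all [a]. *)
Definition class_norm X k (b : cochain X k.+1) : nat :=
  \big[minn/norm b]_(a : cochain X k) norm (b + coboundary a).

Definition expansion_ratio (R : realType) X k (b : cochain X k.+1) : R :=
  (norm (coboundary b))%:R / (class_norm b)%:R.

(* There are finitely many cochains, so the infimum is a minimum as soon as
   C^k X <> B^k X: see [coboundary_expansion_min]. *)
Definition coboundary_expansion (R : realType) X (k : nat) : R :=
  inf [set r : R | exists2 b : cochain X k.+1,
         b \notin coboundaries X k & r = expansion_ratio R b]%classic.

Definition max_degree X (k : nat) : nat :=
  \max_(s in faces X k.+1) #|[set t in faces X k.+2 | s \subset t]|.

Lemma coboundary_expansion_min (R : realType) X k (b0 : cochain X k.+1) :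
  b0 \notin coboundaries X k ->
  exists b : cochain X k.+1,
    [/\ b \notin coboundaries X k,
        coboundary_expansion R X k = expansion_ratio R b
      & forall b' : cochain X k.+1, b' \notin coboundaries X k ->
          expansion_ratio R b <= expansion_ratio R b'].
Proof.
move=> b0B.
case: (@arg_minP _ _ _ b0 (fun b => b \notin coboundaries X k)
         (fun b => expansion_ratio R b) b0B) => b bB bmin.
exists b; split=> //; apply/eqP; rewrite eq_le; apply/andP; split.
- apply: ge_inf; last by exists b.
  by exists (expansion_ratio R b) => _ [b' b'B ->]; exact: bmin.
- apply: lb_le_inf; first by exists (expansion_ratio R b), b.
  by move=> _ [b' b'B ->]; exact: bmin.
Qed.

End Complex.

(* [(i, true)] and [(i, false)] are the vertices e_i and - e_i. *)
Definition cross_vertex (n : nat) : finType := ('I_n * bool)%type.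

Definition crosspolytope (n : nat) : {set {set cross_vertex n}} :=
  [set s : {set cross_vertex n} |
    [forall i : 'I_n, ~~ (((i, true) \in s) && ((i, false) \in s))]].

Definition subcomplex_with (k n : nat) (S : {set {set cross_vertex n}}) :
    {set {set cross_vertex n}} :=
  [set s in crosspolytope n | (#|s| <= k.+1)%N]
    :|: (S :&: faces (crosspolytope n) k.+2).

Lemma crosspolytope_complex n : simplicial_complex (crosspolytope n).
Proof.
split=> [|s t]; rewrite !inE.
  by apply/forallP => i; rewrite !inE.
move=> /forallP sP /subsetP ts; apply/forallP => i.
by apply: contra (sP i) => /andP[/ts -> /ts ->].
Qed.

Lemma subcomplex_with_complex k n (S : {set {set cross_vertex n}}) :
  simplicial_complex (subcomplex_with k S).
Proof.
have [Q0 Qsub] := crosspolytope_complex n.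
split=> [|s t sV ts]; first by rewrite 2!inE Q0 cards0.
have [->//|neq_ts] := eqVneq t s.
have [sQ sk] : s \in crosspolytope n /\ (#|s| <= k.+2)%N.
  move: sV; rewrite in_setU in_setI [_ \in faces _ _]inE inE => /orP[|].
    by case/andP => ? sk; split=> //; exact: leqW.
  by case/and3P => _ ? /eqP ->.
rewrite in_setU inE (Qsub s)//=; apply/orP; left.
rewrite -ltnS; apply: leq_trans sk; apply: proper_card.
by rewrite properEneq neq_ts.
Qed.

(* Probability that the random p-subcomplex V_{n,p} satisfies [E]: each
   (k+1)-face of the cross-polytope independently belongs to the set [S] of
   chosen faces with probability [p]. *)
Definition random_subcomplex_prob (R : realType) (k n : nat) (p : R)
    (E : pred {set {set cross_vertex n}}) : R :=
  \sum_(S in powerset (faces (crosspolytope n) k.+2)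
        | E (subcomplex_with k S))
    \prod_(s in faces (crosspolytope n) k.+2)
      (if s \in S then p else 1 - p).

Lemma random_subcomplex_probT (R : realType) (k n : nat) (p : R) :
  random_subcomplex_prob k p (fun _ : {set {set cross_vertex n}} => true) = 1.
Proof.
rewrite /random_subcomplex_prob; set F := faces _ _.
pose f s := if s \in F then p else 0.
pose g s := if s \in F then 1 - p else 1.
transitivity (\prod_(s : {set cross_vertex n}) (f s + g s)); last first.
  by apply: big1 => s _; rewrite /f /g; case: ifP; rewrite ?add0r ?subrKC.
rewrite bigA_distr [RHS](bigID (fun S => S \in powerset F)) /=.
rewrite [X in _ = _ + X]big1 ?addr0.
  apply: eq_big => [S|S]; first by rewrite andbT.
  rewrite andbT powersetE => SF.
  rewrite big_mkcond /=; apply: eq_bigr => s _; rewrite /f /g.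
  have [//|sF] := boolP (s \in F).
  by rewrite ifN//; apply: contra sF; apply/subsetP.
move=> S; rewrite powersetE => /subsetPn[s sS sF].
by rewrite (bigD1 s)//= sS /f (negPf sF) mul0r.
Qed.

Definition aas (R : realType) (k : nat) (p : nat -> R)
    (E : forall n, pred {set {set cross_vertex n}}) : Prop :=
  ((fun n => random_subcomplex_prob k (p n) (E n)) @ \oo --> (1 : R))%classic.

(* Main.v *)
(** Expansion of the cross-polytope on [n] coordinates.  For a vertex [v], the
    cone with apex [v] modifies a k-cochain [b] by a coboundary so that it
    vanishes on the faces containing [v] and equals [d b (v s)] on the faces [s]
    avoiding [v] and [-v].  On the faces [-v t] it leaves
    [c t = b (v t) + b (-v t)], a (k-1)-cochain of the cross-polytope on the
    other [n - 1] coordinates with [d c s = d b (v s) + d b (-v s)]; by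
    induction it can be made small by a (k-1)-coboundary.  Averaging over the
    [2 n] vertices yields
    [2 (n - k - 1) ||[b]|| <= (k + 2) ||d b||].

    Random subcomplexes.  A nonzero cochain [b] of minimal norm in its class is
    then bad with probability at most [y ^ ||b||], where
    [y = exp (- eps^2 p (n - k - 1) / (k + 2))], by Chernoff's inequality for the
    [||d b||] faces of its coboundary.  Summing over all supports inside the set
    of [N] k-faces gives [(1 + y) ^ N - 1 <= exp (N y) - 1], and the hypothesis on
    [p] forces [N y] to tend to [0].  Singleton supports give the lower bound on
    the degree, and one more Chernoff bound gives the upper one. *)

Require Import Defs.
From mathcomp Require Import all_boot all_order all_algebra.
From mathcomp Require Import boolp classical_sets reals topology normedtype
  sequences derive exp.
From mathcomp Require Import fintype finset zify ring lra.

Set Implicit Arguments.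
Unset Strict Implicit.
Unset Printing Implicit Defensive.

Import Order.TTheory GRing.Theory Num.Theory numFieldNormedType.Exports.
Local Open Scope ring_scope.

(** * Expansion of the cross-polytope *)

Section TotalCochains.
Variable T : finType.
Implicit Types (f g : {set T} -> 'F_2) (s t : {set T}).

(** Cochains are handled as functions on all vertex sets, whose values outside
    the faces of the relevant size are irrelevant. *)
Definition cobd f t : 'F_2 := \sum_(x in t) f (t :\ x).

Lemma F2_addrr (x : 'F_2) : x + x = 0.
Proof. by apply: addrr_pchar2; rewrite pchar_Fp. Qed.

Lemma cobd_setU1 f (v : T) s : v \notin s ->
  cobd f (v |: s) = f s + \sum_(x in s) f (v |: (s :\ x)).
Proof.
move=> vs; rewrite /cobd big_setU1//= setU1K//; congr (_ + _).
apply: eq_bigr => x xs; congr f; rewrite setDUl; congr (_ :|: _).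
apply/setDidPl; rewrite disjoints1 inE.
by apply: contra vs => /eqP ->.
Qed.

(* The term of [t :\ x :\ y] occurs twice, for [(x, y)] and for [(y, x)]. *)
Lemma cobd_cobd f t : cobd (cobd f) t = 0.
Proof.
have -> : cobd (cobd f) t = \sum_(x in t) \sum_(y in t | y != x) f (t :\ x :\ y).
  apply: eq_bigr => x xt; apply: eq_bigl => y.
  by rewrite !inE andbC.
pose r (x y : T) := (enum_rank x < enum_rank y)%N.
have rneq x y : (y != x) = r x y (+) r y x.
  rewrite /r -(inj_eq enum_rank_inj) -val_eqE /=.
  by case: ltngtP.
transitivity (\sum_(x in t) \sum_(y in t | r x y) f (t :\ x :\ y)
            + \sum_(x in t) \sum_(y in t | r y x) f (t :\ x :\ y)).
  rewrite -big_split; apply: eq_bigr => x xt /=.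
  rewrite (bigID (r x)) /=; congr (_ + _); apply: eq_bigl => y;
    rewrite -andbA rneq /r; case: (y \in t) => //=; case: ltngtP => //.
rewrite [X in _ + X](exchange_big_dep (mem t)) /=; last by move=> i j _ /andP[].
rewrite [X in X + _](_ : _ = \sum_(j in t)
  \sum_(i in t | (j \in t) && r j i) f (t :\ i :\ j)) ?F2_addrr //.
apply: eq_bigr => x xt; apply: eq_big => [y|y _]; first by rewrite xt.
by rewrite !setDDl setUC.
Qed.

End TotalCochains.

(** * Cross-polytopes on subsets of the coordinates *)

Section CrossPolytope.
Variable n : nat.
Local Notation T := (cross_vertex n).
Implicit Types (A : {set 'I_n}) (s t : {set T}) (v x : T).

Definition antipode v : T := (v.1, ~~ v.2).

Lemma antipodeK : involutive antipode.
Proof. by case=> i b; rewrite /antipode /= negbK. Qed.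

Lemma fst_antipode v x : x.1 = v.1 -> (x == v) || (x == antipode v).
Proof.
by case: x v => i b [j c] /= ->; rewrite /antipode !xpair_eqE eqxx; case: b; case: c.
Qed.

Lemma crosspolytopeP s :
  reflect (forall x, x \in s -> antipode x \notin s) (s \in crosspolytope n).
Proof.
rewrite inE; apply: (iffP forallP) => [sP [i b] xs|sP i].
  by have := sP i; case: b xs => /= ->; rewrite ?andbT.
by apply/negP => /andP[/sP]; rewrite /antipode /= => /negPf ->.
Qed.

(** The cross-polytope on the coordinates in [A], kept inside the fixed vertex type so that the
    induction can drop a coordinate without relabelling vertices. *)
Definition cross_faces A (m : nat) : {set {set T}} :=
  [set s in faces (crosspolytope n) m | [forall x in s, x.1 \in A]].

Lemma cross_facesP A m s :
  reflect [/\ s \in crosspolytope n, #|s| = m & forall x, x \in s -> x.1 \in A]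
          (s \in cross_faces A m).
Proof.
rewrite [s \in cross_faces _ _]in_set [s \in faces _ _]in_set.
apply: (iffP andP) => [[/andP[? /eqP ?] /forall_inP ?]//|[-> -> ?]].
by split; [rewrite eqxx|apply/forall_inP].
Qed.

Lemma cross_facesT m : cross_faces [set: 'I_n] m = faces (crosspolytope n) m.
Proof.
apply/setP => s; apply/cross_facesP/idP => [[]|]; rewrite [s \in faces _ _]in_set.
  by move=> -> -> _; rewrite eqxx.
by case/andP => ? /eqP ?; split=> // x; rewrite inE.
Qed.

(** Together with [cross_faces_setD1], this makes the link of [v] the cross-polytope on the
    coordinates other than that of [v]. *)
Lemma cross_faces_setU1 A m v s : v.1 \in A -> s \in cross_faces (A :\ v.1) m ->
  v \notin s /\ v |: s \in cross_faces A m.+1.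
Proof.
move=> vA /cross_facesP[/crosspolytopeP sQ <- sA].
have vs w : w.1 = v.1 -> w \notin s.
  by move=> wv; apply/negP => /sA; rewrite wv setD11.
split; first exact: vs.
apply/cross_facesP; split.
- apply/crosspolytopeP => x; rewrite !inE => /predU1P[->|xs].
    rewrite negb_or vs // andbT; case: (v) => i [] //=.
      by rewrite /antipode /= xpair_eqE andbF.
    by rewrite /antipode /= xpair_eqE andbF.
  rewrite negb_or sQ // andbT; apply: contraTneq xs => xv.
  by apply: vs; rewrite -xv.
- by rewrite cardsU1 vs.
- by move=> x; rewrite !inE => /predU1P[->//|/sA]; rewrite inE => /andP[].
Qed.

Lemma cross_faces_setD1 A m v s : v \in s -> s \in cross_faces A m.+1 ->
  v.1 \in A /\ s :\ v \in cross_faces (A :\ v.1) m.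
Proof.
move=> vs /cross_facesP[/crosspolytopeP sQ sm sA]; split; first exact: sA.
apply/cross_facesP; split.
- apply/crosspolytopeP => x; rewrite !inE => /andP[_ /sQ] H.
  by rewrite (negPf H) andbF.
- by move: sm; rewrite (cardsD1 v) vs => -[].
- move=> x; rewrite !inE => /andP[xv xs]; rewrite sA // andbT.
  apply: contra xv => /eqP xv.
  case/orP: (fst_antipode xv) => // /eqP xav.
  by have := sQ _ vs; rewrite -xav => /negP.
Qed.

Lemma cross_faces_widen A m v s : v.1 \in A -> s \in cross_faces A m ->
  v \notin s -> antipode v \notin s -> s \in cross_faces (A :\ v.1) m.
Proof.
move=> vA /cross_facesP[sQ sm sA] vs avs; apply/cross_facesP; split=> // x xs.
rewrite !inE sA // andbT; apply/eqP => /fst_antipode /orP[] /eqP xv.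
  by rewrite xv (negPf vs) in xs.
by rewrite xv (negPf avs) in xs.
Qed.

Definition vertex_coboundary A m (b : {set T} -> 'F_2) v :=
  [set s in cross_faces (A :\ v.1) m | cobd b (v |: s) != 0].

(** [a] is the cone with apex [v], corrected by [a'] on faces through the antipode. Faces through
    [v] then contribute nothing, faces avoiding both vertices give the first term, and faces through
    the antipode give the second. The choice of [a'] is left to the induction hypothesis. *)
Lemma cone_cocycle A m (b : {set T} -> 'F_2) v (a' : {set T} -> 'F_2) :
  v.1 \in A ->
  let c s := b (antipode v |: s) + b (v |: s) in
  exists a : {set T} -> 'F_2,
   (#|[set s in cross_faces A m.+1 | (b s + cobd a s != 0)%R]| <=
   #|vertex_coboundary A m.+1 b v| +
   #|[set s in cross_faces (A :\ v.1) m | (c s + cobd a' s != 0)%R]|)%N.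
Proof.
move=> vA c; set w := antipode v.
have wA : w.1 \in A by [].
have vw : v != w by rewrite /w; case: (v) => i []; rewrite xpair_eqE andbF.
(* The last case is the cone; on the faces containing [w] the values are free,
   and there [a'] corrects what the cone leaves. *)
exists (fun s => if w \in s then a' (s :\ w) else
                 if v \in s then 0 else b (v |: s)).
set a := fun s => _.
set L := [set s in _ | _].
rewrite -(cardsID [set s : {set T} | w \in s] L) addnC leq_add //.
- apply/subset_leq_card/subsetP => s; rewrite in_setD [s \in L]in_set => /andP[+ /andP[sA]].
  rewrite in_set => ws; rewrite [s \in vertex_coboundary _ _ _ _]in_set.
  (* For [v] in [s], the only term of [cobd a s] that can be nonzero is [a (s :\ v) = b s], which
     cancels [b s]. *)
  have [vs|vs] := boolP (v \in s).
    rewrite /cobd (big_setD1 v)//= big1.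
      rewrite addr0 /a !inE (negPf ws) andbF eqxx /= setD1K //.
      by rewrite F2_addrr eqxx.
    move=> x; rewrite !inE => /andP[xv xs].
    by rewrite /a !inE (negPf ws) vs andbF andbT eq_sym xv.
  have sA' : s \in cross_faces (A :\ v.1) m.+1 by exact: cross_faces_widen.
  rewrite sA' cobd_setU1 //=.
  rewrite (_ : cobd a s = \sum_(x in s) b (v |: (s :\ x))) //.
  apply: eq_bigr => x xs; rewrite /a !inE (negPf ws) (negPf vs) !andbF //.
- rewrite -[X in (_ <= X)%N](_ : #|[set w |: s | s in
    [set s in cross_faces (A :\ v.1) m | c s + cobd a' s != 0]]| = _).
    apply/subset_leq_card/subsetP => s; rewrite in_setI [s \in L]in_set => /andP[/andP[sA sd]].
    rewrite in_set => ws.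
    apply/imsetP; exists (s :\ w); last by rewrite setD1K.
    have [_ sA'] := cross_faces_setD1 ws sA.
    rewrite in_set; apply/andP; split => //.
    have /cross_facesP[/crosspolytopeP sQ _ _] := sA.
    have vs : v \notin s by rewrite -[v]antipodeK sQ.
    (* The term [x = w] of [cobd a s] completes [b s] to [c (s :\ w)]; the other terms form
       [cobd a' (s :\ w)]. *)
    move: sd; rewrite /cobd (big_setD1 w)//= addrA /c setD1K //.
    congr (_ + _ + _ != _).
      by rewrite /a !inE eqxx (negPf vs) andbF.
    apply: eq_bigr => x; rewrite !inE => /andP[xw xs].
    by rewrite /a !inE eq_sym xw ws /= setDDl setUC -setDDl.
  apply: card_in_imset => s t; rewrite in_set => /andP[/cross_facesP[_ _ sA] _].
  rewrite in_set => /andP[/cross_facesP[_ _ tA] _] st.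
  have ws (u : {set T}) : (forall x, x \in u -> x.1 \in A :\ v.1) -> w \notin u.
    by move=> uA; apply/negP => /uA; rewrite setD11.
  by rewrite -(setU1K (ws s sA)) st setU1K // ws.
Qed.

Lemma card_vertex_coboundary A m b v : v.1 \in A ->
  (#|vertex_coboundary A m b v| <=
   #|[set t in [set t in cross_faces A m.+1 | (cobd b t != 0)%R] | v \in t]|)%N.
Proof.
move=> vA.
have H s : s \in vertex_coboundary A m b v -> v \notin s /\ v |: s \in cross_faces A m.+1.
  by rewrite in_set => /andP[/(cross_faces_setU1 vA)].
rewrite -(@card_in_imset _ _ (fun s => v |: s)); last first.
  by move=> s t /H[vs _] /H[vt _] st; rewrite -(setU1K vs) st setU1K.
apply/subset_leq_card/subsetP => _ /imsetP[s sP ->].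
have [_ svA] := H _ sP; move: sP; rewrite in_set => /andP[_ sd].
by rewrite in_set setU11 andbT in_set svA.
Qed.

(** Double counting of incidences: a face of size [m.+1] in the support of [cobd b] is seen from at
    most its [m.+1] vertices. *)
Lemma sum_vertex_coboundary A m b :
  (\sum_(v : T | v.1 \in A) #|vertex_coboundary A m b v| <=
   m.+1 * #|[set t in cross_faces A m.+1 | (cobd b t != 0)%R]|)%N.
Proof.
set Z := [set t in _ | _].
apply: (@leq_trans (\sum_(v : T) #|[set t in Z | v \in t]|)).
  rewrite big_mkcond leq_sum // => v _; case: ifP => // vA.
  exact: card_vertex_coboundary.
under eq_bigr do rewrite -sum1_card.
rewrite (exchange_big_dep (mem Z)) /=; last by move=> v t _; rewrite in_set => /andP[].
rewrite mulnC -sum_nat_const leq_sum // => t tZ.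
have /cross_facesP[_ <- _] : t \in cross_faces A m.+1 by move: tZ; rewrite in_set => /andP[].
rewrite sum1_card; apply: subset_leq_card; apply/subsetP => v.
move=> vt; have : t \in [set u in Z | v \in u] by []. 
by rewrite in_set => /andP[].
Qed.

Lemma card_vertices A : #|[set v : T | v.1 \in A]| = (2 * #|A|)%N.
Proof.
rewrite (_ : [set v : T | _] = setX A [set: bool]); last first.
  by apply/setP => v; rewrite !inE andbT.
by rewrite cardsX cardsT card_bool mulnC.
Qed.

Lemma cross_faces0 A : cross_faces A 0 = [set set0].
Proof.
apply/setP => s; rewrite in_set1; apply/cross_facesP/eqP => [[_ /cards0_eq]//|->].
split; rewrite ?cards0//; last by move=> x; rewrite inE.
by apply/crosspolytopeP => x; rewrite inE.
Qed.

(** Induction on [m] for all [A] and [b]: passing to the link of a vertex lowers both the size and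
    the number of coordinates by one, so [#|A| - m] is preserved. *)
Lemma cross_faces_expansion A m (b : {set T} -> 'F_2) :
  exists a : {set T} -> 'F_2,
    (2 * (#|A| - m) * #|[set s in cross_faces A m | (b s + cobd a s != 0)%R]|
     <= m.+1 * #|[set t in cross_faces A m.+1 | (cobd b t != 0)%R]|)%N.
Proof.
elim: m A b => [|m IH] A b.
  (* The only face of size 0 is empty, and [cobd a set0 = 0]. If [b set0] is nonzero, all [2 * #|A|]
     vertices lie in the support of [cobd b]. *)
  exists (fun=> 0); rewrite subn0 mul1n.
  have [b0|b0] := eqVneq (b set0) 0.
    rewrite (_ : [set s in _ | _] = set0) ?cards0 ?muln0//.
    apply/setP => s; rewrite cross_faces0 !inE; apply/negP => /andP[/eqP ->].
    by rewrite b0 /cobd big_set0 addr0 eqxx.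
  rewrite (@leq_trans (2 * #|A|)%N) //.
    rewrite -[leqRHS]muln1 leq_mul //.
    apply: leq_trans (eq_leq (cards1 (set0 : {set T}))).
    apply/subset_leq_card/subsetP => s.
    by rewrite cross_faces0 in_set => /andP[].
  rewrite -card_vertices -(card_imset _ (@set1_inj T)).
  apply/subset_leq_card/subsetP => _ /imsetP[v + ->]; rewrite in_set => vA; rewrite in_set.
  have := @cross_faces_setU1 A 0 v set0 vA.
  rewrite cross_faces0 setU0 inE eqxx => -[]// _ ->.
  by rewrite /cobd big_set1 setDv.
have [Am|mA] := leqP #|A| m.+1.
  by exists (fun=> 0); rewrite (eqP Am).
(* If no [a] works then no vertex provides one; the resulting strict
   inequalities, summed over the vertices, are contradictory. *)
apply: contrapT => /forallNP H.
pose P v := #|vertex_coboundary A m.+1 b v|.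
set Z := #|[set t in cross_faces A m.+2 | _]| in H.
have step v : v.1 \in A ->
    (m.+2 * Z < 2 * (#|A| - m.+1) * P v + m.+1 * (P v + P (antipode v)))%N.
  move=> vA.
  pose c s := b (antipode v |: s) + b (v |: s).
  have [a' Ha'] := IH (A :\ v.1) c.
  have [a Ha] := @cone_cocycle A m b v a' vA.
  have /negP := H a; rewrite -ltnNge => Hlt.
  apply: (leq_trans Hlt).
  have cA : (#|A :\ v.1| - m = #|A| - m.+1)%N.
    by rewrite (cardsD1 v.1 A) vA.
  apply: leq_trans (leq_mul (leqnn _) Ha) _.
  rewrite mulnDr leq_add2l -cA; apply: leq_trans Ha' _.
  rewrite leq_mul // /P.
  apply: leq_trans (leq_card_setU _ _).
  apply/subset_leq_card/subsetP => s; rewrite in_setU [_ \in [set _ in _ | _]]in_set => /andP[sA].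
  rewrite ![_ \in vertex_coboundary _ _ _ _]in_set sA.
  have [vs _] := cross_faces_setU1 vA sA.
  have [ws _] := @cross_faces_setU1 A m.+1 (antipode v) s vA sA.
  rewrite -negb_and; apply: contra => /andP[/eqP dv /eqP dw].
  (* The term [b s] occurs in both coboundaries on the right and cancels mod 2. *)
  have -> : cobd c s = cobd b (antipode v |: s) + cobd b (v |: s).
    by rewrite !cobd_setU1 // addrACA F2_addrr add0r /cobd big_split.
  by rewrite dv dw addr0.
have := @leq_sum _ (index_enum T) (fun v : T => v.1 \in A) _ _ step.
rewrite sum_nat_const -cardsE card_vertices big_split -!big_distrr /= big_split /=.
have -> : (\sum_(v : T | v.1 \in A) P (antipode v) = \sum_(v : T | v.1 \in A) P v)%N.
  by rewrite [RHS](reindex_inj (inv_inj antipodeK)).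
have : (\sum_(v : T | v.1 \in A) P v <= m.+2 * Z)%N.
  exact: sum_vertex_coboundary.
(* Since [2 (#|A| - m - 1) + 2 (m + 1) = 2 #|A|], the strict inequalities add up to [z < S], against
   [S <= z]. *)
move: (\sum_(v : T | v.1 \in A) P v)%N (m.+2 * Z)%N => S z Sz.
rewrite (_ : _ + _ = 2 * #|A| * S)%N.
  rewrite leq_pmul2l; last by rewrite muln_gt0 /=; exact: leq_trans mA.
  by rewrite ltnNge Sz.
by rewrite addnn -mul2n mulnCA -!mulnA -!mulnDr -mulnDl subnK // ltnW.
Qed.
End CrossPolytope.

(** * Cochains of a complex as total functions *)

Lemma eq_card_set_in (T : finType) (A : {set T}) (p q : pred T) :
  {in A, p =1 q} -> #|[set s in A | p s]| = #|[set s in A | q s]|.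
Proof.
move=> pq; apply: eq_card => s; rewrite !in_set.
by have [/pq|//] := boolP (s \in A).
Qed.

Section Cochains.
Variables (T : finType) (X : {set {set T}}).
Implicit Types (f g : {set T} -> 'F_2) (s t : {set T}).

Definition extend m (b : cochain X m) s : 'F_2 := oapp b 0 (insub s).

Definition restrict m f : cochain X m :=
  [ffun y : {s : {set T} | s \in faces X m} => f (val y)].

Lemma extend_val m (b : cochain X m) y : extend b (val y) = b y.
Proof. by rewrite /extend valK. Qed.

Lemma extend_restrict m f s : s \in faces X m -> extend (restrict m f) s = f s.
Proof. by move=> sX; rewrite /extend insubT /= ffunE. Qed.

Lemma extendD m (b b' : cochain X m) s :
  extend (b + b') s = extend b s + extend b' s.
Proof.
by rewrite /extend; case: insub => [y|] /=; rewrite ?ffunE ?addr0.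
Qed.

Lemma normE m (b : cochain X m) :
  norm b = #|[set s in faces X m | extend b s != 0]|.
Proof.
rewrite /norm -(card_imset _ val_inj); apply: eq_card => s.
apply/imsetP/idP => [[y]|]; rewrite in_set.
  by move=> by0 ->; rewrite in_set extend_val by0 andbT; exact: (valP y).
case/andP => sX bs; exists (exist _ s sX) => //.
by rewrite in_set -extend_val.
Qed.

Lemma eq_cobd m f g t : simplicial_complex X ->
  t \in faces X m.+1 -> {in faces X m, f =1 g} -> cobd f t = cobd g t.
Proof.
move=> [_ Xsub]; rewrite in_set => /andP[tX /eqP tm] fg.
apply: eq_bigr => x xt; apply: fg; rewrite in_set.
rewrite (Xsub _ _ tX) ?subsetDl //=.
by have := cardsD1 x t; rewrite tm xt add1n => -[<-].
Qed.

(** The faces of size [m] inside [t] are exactly the sets [t :\ x] for [x] in [t]. *)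
Lemma coboundaryE m (b : cochain X m) y : simplicial_complex X ->
  coboundary b y = cobd (extend b) (val y).
Proof.
move=> [_ Xsub]; case: y => t tX /=; rewrite ffunE /=.
under eq_bigr do rewrite -extend_val.
rewrite -(big_sub_cond _ (fun s => s \subset t)) /=.
move: tX; rewrite in_set => /andP[tX /eqP tm].
have inj : {in t &, injective (fun x => t :\ x)}.
  move=> x y xt yt txy; apply/eqP; apply: contraT => xy.
  have : x \in t :\ y by rewrite !inE xy.
  by rewrite -txy setD11.
rewrite /cobd -(big_imset _ inj) /=; apply: eq_bigl => s.
apply/andP/imsetP => [[]|[x xt ->]].
  rewrite in_set => /andP[sX /eqP sm] st.
  have /eqP : #|t :\: s| = 1%N.
    by rewrite cardsD (setIidPr st) tm sm subSnn.
  case/cards1P => x tsx; have : x \in t :\: s by rewrite tsx set11.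
  rewrite in_setD => /andP[xs xt]; exists x => //.
  by rewrite -tsx setDDr setDv set0U (setIidPr st).
rewrite subsetDl in_set (Xsub _ _ tX) ?subsetDl //=.
by have := cardsD1 x t; rewrite tm xt add1n => -[<-].
Qed.

Hypothesis XC : simplicial_complex X.

Lemma coboundaryD m (b b' : cochain X m) :
  coboundary (b + b') = coboundary b + coboundary b'.
Proof.
apply/ffunP => y; rewrite !ffunE -big_split; apply: eq_bigr => x _.
by rewrite ffunE.
Qed.

Lemma coboundary_coboundary m (b : cochain X m) :
  coboundary (coboundary b) = 0.
Proof.
apply/ffunP => y; rewrite coboundaryE // ffunE -[RHS](cobd_cobd (extend b) (val y)).
apply: eq_cobd (valP y) _ => // s sX.
by rewrite -[s]/(val (exist (fun s => s \in faces X m.+1) s sX)) extend_val coboundaryE.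
Qed.

Lemma class_norm_min k (b : cochain X k.+1) :
  exists2 a : cochain X k, class_norm b = norm (b + coboundary a)
    & forall a' : cochain X k, (class_norm b <= norm (b + coboundary a')%R)%N.
Proof.
have le a' : (class_norm b <= norm (b + coboundary a')%R)%N.
  rewrite /class_norm -minEnat.
  exact: (@bigmin_le _ nat _ _ _ (fun a => norm (b + coboundary a))).
case: (@arg_minnP _ 0 predT (fun a : cochain X k => norm (b + coboundary a))) => // a _ amin.
exists a => //; apply/eqP; rewrite eqn_leq le /=.
rewrite /class_norm -minEnat; apply: (@le_bigmin _ nat); last by move=> i _; exact: amin.
have := amin 0 isT; rewrite (_ : coboundary 0 = 0) ?addr0 //.
by apply: (addIr (coboundary (0 : cochain X k))); rewrite -coboundaryD !add0r.
Qed.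

Lemma noncoboundary k (b : cochain X k.+1) :
  coboundary b != 0 -> b \notin coboundaries X k.
Proof.
by apply: contra => /imsetP[a _ ->]; rewrite coboundary_coboundary.
Qed.

(** Adding a coboundary does not change [coboundary b], so only cochains of least norm in their
    class need testing. The first hypothesis makes the infimum a minimum. *)
Lemma coboundary_expansion_ge (R : realType) k (c : R) :
  (exists b0 : cochain X k.+1, b0 \notin coboundaries X k) ->
  (forall b : {set T} -> 'F_2,
     (0 < #|[set s in faces X k.+1 | (b s != 0)%R]|)%N ->
     (forall a : {set T} -> 'F_2, #|[set s in faces X k.+1 | (b s != 0)%R]|
        <= #|[set s in faces X k.+1 | (b s + cobd a s != 0)%R]|)%N ->
     c * #|[set s in faces X k.+1 | (b s != 0)%R]|%:R <=
       #|[set t in faces X k.+2 | cobd b t != 0]|%:R) ->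
  c <= coboundary_expansion R X k.
Proof.
case=> b0 b0B H; have [b [bB -> _]] := coboundary_expansion_min R b0B.
rewrite /expansion_ratio.
have [a Ea amin] := class_norm_min b.
pose b' := b + coboundary a.
have Nb' : class_norm b = #|[set s in faces X k.+1 | extend b' s != 0]|.
  by rewrite Ea normE.
(* If the class norm were 0, then [b + coboundary a = 0], that is [b = coboundary a] mod 2. *)
have N0 : (0 < class_norm b)%N.
  rewrite Ea lt0n; apply: contra bB => /eqP/cards0_eq N0; apply/imsetP.
  exists a => //; apply/ffunP => y; apply: (addIr (coboundary a y)); rewrite F2_addrr.
  have : y \notin [set y | (b + coboundary a) y != 0] by rewrite N0 in_set0.
  by rewrite in_set negbK ffunE => /eqP.
rewrite ler_pdivlMr ?ltr0n //.
have -> : coboundary b = coboundary b'.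
  by rewrite coboundaryD coboundary_coboundary addr0.
have -> : norm (coboundary b') = #|[set t in faces X k.+2 | cobd (extend b') t != 0]|.
  rewrite normE; apply: eq_card_set_in => t tX; congr (_ != 0).
  by rewrite -[t]/(val (exist (fun s => s \in faces X k.+2) t tX)) extend_val coboundaryE.
rewrite Nb' in N0 amin *; apply: H => // a'.
apply: leq_trans (amin (a + restrict k a')) _.
rewrite normE; apply/eq_leq/eq_card_set_in => s sX; congr (_ != 0).
rewrite coboundaryD addrA extendD; congr (_ + _).
rewrite -[s]/(val (exist (fun s => s \in faces X k.+1) s sX)) extend_val coboundaryE //.
by apply: eq_cobd sX _ => // t tX; exact: extend_restrict.
Qed.
End Cochains.

(** * Subcomplexes of the cross-polytope *)

Section Subcomplex.
Variables (n k : nat).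
Local Notation T := (cross_vertex n).
Local Notation Qfaces := (faces (crosspolytope n)).
Implicit Types (s t : {set T}) (B S : {set {set T}}).

(** A cochain mod 2 is determined by its support, so the random events can be indexed by sets of
    faces. *)
Definition indicator B s : 'F_2 := (s \in B)%:R.

Definition cross_coboundary m B : {set {set T}} :=
  [set t in Qfaces m.+1 | cobd (indicator B) t != 0].

Lemma indicator_support (b : {set T} -> 'F_2) (A : {set {set T}}) s : s \in A ->
  indicator [set s in A | b s != 0] s = b s.
Proof.
move=> sA; rewrite /indicator in_set sA /=.
by case: (b s) => [[|[|]]//= i]; apply: val_inj.
Qed.

Lemma faces_subcomplex_low S :
  faces (subcomplex_with k S) k.+1 = Qfaces k.+1.
Proof.
apply/setP => s; rewrite ![_ \in faces _ _]in_set in_setU in_setI.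
rewrite [s \in faces _ _]in_set [s \in [set _ in _ | _]]in_set.
have [->|_] := eqVneq #|s| k.+1; last by rewrite !andbF.
by rewrite leqnn (ltn_eqF (ltnSn _)) !andbT !andbF orbF.
Qed.

Lemma faces_subcomplex_top S : S \subset Qfaces k.+2 ->
  faces (subcomplex_with k S) k.+2 = S.
Proof.
move=> /subsetP SF; apply/setP => s.
rewrite ![_ \in faces (subcomplex_with _ _) _]in_set in_setU in_setI.
rewrite [s \in [set _ in _ | _]]in_set.
have [sS|sS] := boolP (s \in S).
  by have := SF _ sS; rewrite in_set => /andP[-> /eqP ->]; rewrite ltnn eqxx orbT.
have [->|_] := eqVneq #|s| k.+2; last by rewrite !andbF.
by rewrite ltnn !andbF.
Qed.

Lemma upper_faces m s : s \in Qfaces m ->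
  [set t in Qfaces m.+1 | s \subset t] =
  [set v |: s | v in [set v : T | v.1 \in ~: [set x.1 | x in s]]].
Proof.
move=> sQ; apply/setP => t; rewrite in_set; apply/andP/imsetP.
  case=> tQ st; move: (tQ) (sQ).
  rewrite -!cross_facesT => /cross_facesP[/crosspolytopeP tC tm _] /cross_facesP[_ sm _].
  have /eqP/cards1P[v tsv] : #|t :\: s| = 1%N.
    by rewrite cardsD (setIidPr st) tm sm subSnn.
  have : v \in t :\: s by rewrite tsv set11.
  rewrite in_setD => /andP[vs vt]; exists v; last first.
    by rewrite -tsv setUC -{1}(setIidPr st) setID.
  rewrite in_set in_setC; apply/imsetP => -[x xs /esym /fst_antipode /orP[]/eqP xv].
    by rewrite -xv xs in vs.
  by have := tC _ vt; rewrite -xv (subsetP st).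
case=> v; rewrite in_set in_setC => vs ->; split; last exact: subsetUr.
have := @cross_faces_setU1 n setT m v s (in_setT _).
rewrite cross_facesT; case=> //.
move: sQ; rewrite -cross_facesT => /cross_facesP[sC sm _].
apply/cross_facesP; split=> // x xs; rewrite in_setD1 in_setT andbT.
by apply: contraNneq vs => <-; exact: imset_f.
Qed.

Lemma card_upper_faces m s : s \in Qfaces m ->
  #|[set t in Qfaces m.+1 | s \subset t]| = (2 * (n - m))%N.
Proof.
move=> sQ; rewrite upper_faces // card_in_imset.
  rewrite card_vertices cardsCs setCK card_ord.
  move: sQ; rewrite -cross_facesT => /cross_facesP[/crosspolytopeP sC <- _].
  rewrite card_in_imset // => x y xs ys /fst_antipode /orP[/eqP //|/eqP xy].
  by have := sC _ ys; rewrite -xy xs.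
have vs v : v \in [set v : T | v.1 \in ~: [set x.1 | x in s]] -> v \notin s.
  by rewrite in_set in_setC; apply: contra; exact: imset_f.
move=> v w /vs vs' _ vw; have : v \in w |: s by rewrite -vw setU11.
by rewrite in_setU1 (negPf vs') orbF => /eqP.
Qed.

(** This turns expansion bounds for singleton supports into degree bounds. *)
Lemma cross_coboundary1 m s : s \in Qfaces m ->
  cross_coboundary m [set s] = [set t in Qfaces m.+1 | s \subset t].
Proof.
move=> sQ; apply/setP => t; rewrite [t \in cross_coboundary _ _]in_set.
rewrite [t \in [set _ in _ | s \subset _]]in_set.
have [tQ /=|//] := boolP (t \in Qfaces m.+1); apply/idP/idP => [|st].
  apply: contraR => st; apply/eqP; apply: big1 => x xt.
  rewrite /indicator in_set1; case: eqP => // tx.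
  by rewrite -tx subsetDl in st.
have : t \in [set t in Qfaces m.+1 | s \subset t] by rewrite in_set tQ.
rewrite upper_faces // => /imsetP[v]; rewrite in_set in_setC => vs ->.
have vs' : v \notin s by apply: contra vs; exact: imset_f.
rewrite cobd_setU1 // big1 ?addr0 /indicator ?set11 // => x xs.
rewrite in_set1; case: eqP => // sv.
by rewrite -sv setU11 in vs'.
Qed.

Lemma faces_nonempty m : (m <= n)%N -> exists s, s \in Qfaces m.
Proof.
move=> mn; exists [set ((widen_ord mn i, true) : T) | i in 'I_m].
rewrite -cross_facesT; apply/cross_facesP; split => [||x]; rewrite ?in_setT //.
  apply/crosspolytopeP => _ /imsetP[i _ ->].
  by apply/imsetP => -[j _ []].
by rewrite card_imset ?card_ord // => i j [] /val_inj.
Qed.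

(** * Deterministic consequences of expansion within the chosen faces *)

Section Expanding.
Variables (R : realType) (c : R) (S : {set {set T}}).
Hypotheses (kn : (k.+1 < n)%N) (SF : S \subset Qfaces k.+2) (c0 : 0 < c).
Hypothesis expanding : forall B, B \subset Qfaces k.+1 -> B != set0 ->
  (2 * (n - k.+1) * #|B| <= k.+2 * #|cross_coboundary k.+1 B|)%N ->
  c * #|B|%:R <= #|cross_coboundary k.+1 B :&: S|%:R.

Let V := subcomplex_with k S.
Let VC : simplicial_complex V. Proof. exact: subcomplex_with_complex. Qed.

(** The coboundary of a single face has [2 * (n - k.+1)] faces, so singletons meet the size
    condition of [expanding]. *)
Let expanding1 s : s \in Qfaces k.+1 ->
  c <= #|[set t in Qfaces k.+2 | s \subset t] :&: S|%:R.
Proof.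
move=> sQ; rewrite -cross_coboundary1 //.
have := @expanding [set s]; rewrite cards1 mulr1; apply.
- by rewrite sub1set.
- by apply/set0Pn; exists s; rewrite set11.
- rewrite cross_coboundary1 // card_upper_faces // muln1.
  by rewrite -[leqLHS]mul1n leq_mul.
Qed.

Lemma expanding_max_degree : c <= (max_degree V k)%:R.
Proof.
have [s sQ] := faces_nonempty (ltnW kn).
apply: (le_trans (expanding1 sQ)); rewrite ler_nat.
have sV : s \in faces V k.+1 by rewrite faces_subcomplex_low.
apply: leq_trans (leq_bigmax_cond _ sV).
apply/subset_leq_card/subsetP => t; rewrite in_setI in_set => /andP[/andP[_ st] tS].
by rewrite in_set faces_subcomplex_top // tS.
Qed.

Lemma expanding_coboundary_expansion : c <= coboundary_expansion R V k.
Proof.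
have [s sQ] := faces_nonempty (ltnW kn).
have ES : faces V k.+2 = S by exact: faces_subcomplex_top.
have EF : faces V k.+1 = Qfaces k.+1 by exact: faces_subcomplex_low.
apply: coboundary_expansion_ge => //.
  (* As [c > 0], some chosen face contains [s]; hence the indicator of [s] is not a cocycle of
     [V]. *)
  exists (restrict V k.+1 (indicator [set s])); apply: noncoboundary => //.
  have := lt_le_trans c0 (expanding1 sQ); rewrite ltr0n card_gt0 => /set0Pn[t].
  rewrite -cross_coboundary1 // in_setI in_set => /andP[/andP[tQ dt]].
  rewrite -ES => tV; apply: contra dt => /eqP d0.
  have := congr1 (fun b => extend b t) d0.
  rewrite -[t]/(val (exist (fun s => s \in faces V k.+2) t tV)) !extend_val /=.
  rewrite coboundaryE // ffunE => <-; apply/eqP.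
  by apply: eq_cobd tV _ => // u uV; rewrite extend_restrict.
move=> b; rewrite EF ES; set B := [set s in _ | _] => B0 Bmin.
have dB t : t \in Qfaces k.+2 -> cobd (indicator B) t = cobd b t.
  move=> tQ; apply: eq_cobd tQ _; first exact: crosspolytope_complex.
  by move=> u uQ; rewrite indicator_support.
apply: le_trans (expanding _ _ _) _.
- by apply/subsetP => u; rewrite in_set => /andP[].
- by rewrite -card_gt0.
(* Minimality of [b] against this [a] transfers the expansion inequality to the support [B]. *)
- have [a] := @cross_faces_expansion n setT k.+1 b.
  rewrite cardsT card_ord !cross_facesT => Ha.
  have -> : #|cross_coboundary k.+1 B| = #|[set t in Qfaces k.+2 | cobd b t != 0]|.
    by apply: eq_card_set_in => t tQ; rewrite /= dB.
  by apply: leq_trans Ha; rewrite leq_mul.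
- rewrite ler_nat; apply/subset_leq_card/subsetP => t.
  rewrite in_setI => /andP[tB tS]; rewrite in_set tS /=.
  by move: tB; rewrite in_set => /andP[tQ]; rewrite dB.
Qed.

End Expanding.
End Subcomplex.

(** * Chernoff bounds *)

(** The difference of the two sides vanishes at 0 and has derivative [expR y - (1 + y) >= 0]. *)
Lemma expR_ge_quadratic (R : realType) (x : R) : 0 <= x ->
  1 + x + x ^+ 2 / 2 <= expR x.
Proof.
move=> x0; rewrite -subr_ge0.
pose g : R -> R := fun y => expR y - (1 + y + 2^-1 * y ^+ 2).
have dg (y : R) : is_derive y (1 : R) g (expR y - (1 + y)).
  apply: is_derive_eq; rewrite add0r scaler1 /=.
  by congr (_ - (_ + _)); rewrite /GRing.scale /=; field.
have : g 0 <= g x.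
  apply: (@ger0_derive1_ndecry R g 0) => //.
  - by move=> y _; rewrite derive1E derive_val subr_ge0 expR_ge1Dx.
  - apply: continuous_subspaceT => y; apply: differentiable_continuous.
    exact/derivable1_diffP.
by rewrite /g expR0 expr0n mulr0 !addr0 subrr (mulrC 2^-1).
Qed.

(** The two quadratics multiply to [1 + (x^2 / 2)^2 >= 1], while [expR (- x)] times the first is at
    most 1. *)
Lemma expRN_le_quadratic (R : realType) (x : R) : 0 <= x ->
  expR (- x) <= 1 - x + x ^+ 2 / 2.
Proof.
move=> x0; have q0 : 0 < 1 + x + x ^+ 2 / 2 by have := sqr_ge0 x; lra.
rewrite -(ler_pM2r q0); apply: (@le_trans _ _ 1).
  by rewrite -[leRHS](expRxMexpNx_1 x) mulrC ler_wpM2r ?expR_ge0 // expR_ge_quadratic.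
rewrite -subr_ge0 (_ : _ - 1 = (x ^+ 2 / 2) ^+ 2) ?sqr_ge0 //; by field.
Qed.

Lemma sum_powerset_prod (R : comRingType) (I : finType) (F : {set I}) (f g : I -> R) :
  \sum_(S in powerset F) \prod_(s in F) (if s \in S then f s else g s) =
  \prod_(s in F) (f s + g s).
Proof.
(* The values 0 and 1 outside [F] kill every set not contained in [F] when the product is expanded
   over all sets. *)
pose f' s := if s \in F then f s else 0.
pose g' s := if s \in F then g s else 1.
transitivity (\prod_s (f' s + g' s)); last first.
  rewrite [RHS]big_mkcond; apply: eq_bigr => s _; rewrite /f' /g'.
  by case: ifP => // _; rewrite add0r.
rewrite bigA_distr [RHS](bigID (fun S => S \in powerset F)) /=.
rewrite [X in _ = _ + X]big1 ?addr0.
  apply: eq_big => [S //|S].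
  rewrite powersetE => SF; rewrite big_mkcond; apply: eq_bigr => s _.
  rewrite /f' /g'; have [//|sF] := boolP (s \in F).
  by rewrite ifN//; apply: contra sF; apply/subsetP.
move=> S; rewrite powersetE => /subsetPn[s sS sF].
by rewrite (bigD1 s)//= sS /f' (negPf sF) mul0r.
Qed.

Lemma sum_powerset_expr (R : comRingType) (I : finType) (F : {set I}) (y : R) :
  \sum_(S in powerset F) y ^+ #|S| = (y + 1) ^+ #|F|.
Proof.
rewrite -prodr_const -(sum_powerset_prod F (fun=> y) (fun=> 1)).
apply: eq_bigr => S; rewrite powersetE => /setIidPr SF.
rewrite -[in LHS]SF -big_mkcondr prodr_const; congr (_ ^+ _).
by apply: eq_card => s; rewrite in_setI.
Qed.

Section FirstMoment.
Variables (R : realType) (I : finType) (F : {set I}) (p : R).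
Hypotheses (p0 : 0 <= p) (p1 : p <= 1).

Definition weight (S : {set I}) : R :=
  \prod_(s in F) (if s \in S then p else 1 - p).

Definition expectation (G : {set I} -> R) : R :=
  \sum_(S in powerset F) weight S * G S.

Lemma weight_ge0 S : 0 <= weight S.
Proof. by apply: prodr_ge0 => s _; case: ifP => _ //; rewrite subr_ge0. Qed.

Lemma expectationZ c G : expectation (fun S => c * G S) = c * expectation G.
Proof. by rewrite mulr_sumr; apply: eq_bigr => S _; rewrite mulrCA. Qed.

(** By independence the generating function factors: a face of [D] contributes [p z + (1 - p)], any
    other face of [F] contributes 1. *)
Lemma expectation_expr (D : {set I}) (z : R) : D \subset F ->
  expectation (fun S => z ^+ #|D :&: S|) = (1 + p * (z - 1)) ^+ #|D|.
Proof.
move=> DF; rewrite /expectation.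
transitivity (\sum_(S in powerset F) \prod_(s in F)
    (if s \in S then p * (if s \in D then z else 1) else 1 - p)).
  apply: eq_bigr => S; rewrite powersetE => SF.
  rewrite -prodr_const (_ : \prod_(s in D :&: S) z =
    \prod_(s in F) (if s \in S then if s \in D then z else 1 else 1)).
    by rewrite -big_split; apply: eq_bigr => s _ /=; case: ifP; rewrite ?mulr1.
  rewrite [RHS](big_setID (D :&: S)) /= [X in _ = _ * X]big1 ?mulr1.
    have /setIidPr -> : D :&: S \subset F by rewrite subIset ?DF.
    by apply: eq_bigr => s; rewrite in_setI => /andP[-> ->].
  by move=> s; rewrite !inE negb_and => /andP[/orP[]/negPf -> _] //; case: ifP.
rewrite sum_powerset_prod (big_setID D) /= (setIidPr DF) [X in _ * X]big1 ?mulr1.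
  by rewrite -prodr_const; apply: eq_bigr => s ->; ring.
by move=> s; rewrite inE => /andP[/negPf -> _]; rewrite mulr1 subrKC.
Qed.

(* The exponential moment is taken at [eps] instead of the optimal
   [- ln (1 - eps)], which is enough for the exponent [eps ^+ 2 / 2]. *)
Lemma chernoff_lower (D : {set I}) (eps : R) : D \subset F -> 0 <= eps ->
  expectation (fun S => expR (eps * ((1 - eps) * p * #|D|%:R - #|D :&: S|%:R)))
  <= expR (- (eps ^+ 2 / 2 * p * #|D|%:R)).
Proof.
move=> DF e0.
have E S : expR (eps * ((1 - eps) * p * #|D|%:R - #|D :&: S|%:R)) =
   expR (eps * (1 - eps) * p) ^+ #|D| * expR (- eps) ^+ #|D :&: S|.
  by rewrite -!expRM_natl -expRD; congr expR; ring.
rewrite (funext E) expectationZ (expectation_expr _ DF) -exprMn.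
rewrite -[in leRHS]mulNr expRM_natr lerXn2r ?nnegrE ?expR_ge0 //.
  rewrite mulr_ge0 ?expR_ge0 // -[X in X + _](subrK p 1) -addrA mulrBr mulr1 subrKC.
  by rewrite addr_ge0 ?subr_ge0 // mulr_ge0 // expR_ge0.
have -> : - (eps ^+ 2 / 2 * p) = eps * (1 - eps) * p + p * (- eps + eps ^+ 2 / 2).
  by field.
rewrite expRD ler_wpM2l ?expR_ge0 //; apply: le_trans (expR_ge1Dx _).
rewrite lerD2l ler_wpM2l //; have := expRN_le_quadratic e0; lra.
Qed.

(** The exponential moment at 1 against the threshold [expR 1 * p] per face leaves the exponent
    [p (e - 1) - e p = - p]. *)
Lemma chernoff_upper (D : {set I}) : D \subset F ->
  expectation (fun S => expR (#|D :&: S|%:R - expR 1 * p * #|D|%:R))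
  <= expR (- (p * #|D|%:R)).
Proof.
move=> DF.
have E S : expR (#|D :&: S|%:R - expR 1 * p * #|D|%:R) =
   expR (- (expR 1 * p)) ^+ #|D| * expR 1 ^+ #|D :&: S|.
  by rewrite -!expRM_natl -expRD; congr expR; ring.
rewrite (funext E) expectationZ (expectation_expr _ DF) -exprMn.
rewrite -[in leRHS]mulNr expRM_natr lerXn2r ?nnegrE ?expR_ge0 //.
  rewrite mulr_ge0 ?expR_ge0 // addr_ge0 // mulr_ge0 // subr_ge0.
  by apply: le_trans (expR_ge1Dx 1); rewrite lerDl.
have -> : - p = - (expR 1 * p) + p * (expR 1 - 1) by ring.
by rewrite expRD ler_wpM2l ?expR_ge0 // expR_ge1Dx.
Qed.

End FirstMoment.

(** * First moment bound *)

Lemma bin_leq_expn n m : ('C(n, m) <= n ^ m)%N.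
Proof.
have ffact_leq : (n ^_ m <= n ^ m)%N.
  by elim: m => // m IH; rewrite ffactnSr expnSr leq_mul // leq_subr.
apply: leq_trans ffact_leq.
by rewrite -bin_ffact leq_pmulr // fact_gt0.
Qed.

Lemma card_faces_crosspolytope n m :
  (#|faces (crosspolytope n) m| <= (2 * n) ^ m)%N.
Proof.
apply: leq_trans (bin_leq_expn _ _).
have -> : (2 * n = #|cross_vertex n|)%N by rewrite card_prod card_ord card_bool mulnC.
rewrite -card_draws; apply/subset_leq_card/subsetP => s.
by rewrite !in_set => /andP[].
Qed.

Lemma le_term_sum (R : numDomainType) (I : finType) (P : pred I) (F : I -> R) i :
  P i -> (forall j, P j -> 0 <= F j) -> F i <= \sum_(j | P j) F j.
Proof.
move=> Pi F0; rewrite (bigD1 i) //= lerDl sumr_ge0 // => j /andP[Pj _].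
exact: F0.
Qed.

Section Failure.
Variables (R : realType) (k n : nat) (p eps : R).
Hypotheses (kn : (k.+1 < n)%N) (p0 : 0 < p) (p1 : p <= 1).
Hypotheses (eps0 : 0 < eps) (eps1 : eps < 1).

Local Notation T := (cross_vertex n).
Local Notation Qfaces := (faces (crosspolytope n)).
Let F := Qfaces k.+2.
Let upper (s : {set T}) := [set t in F | s \subset t].
Let M : R := (2 * (n - k.+1))%:R.

Lemma random_subcomplex_prob_le1 (E : pred {set {set T}}) :
  random_subcomplex_prob k p E <= 1.
Proof.
rewrite -(random_subcomplex_probT k n p) /random_subcomplex_prob.
rewrite !big_mkcondr /=; apply: ler_sum => S _; case: ifP => // _.
by apply: weight_ge0 => //; exact: ltW.
Qed.

Lemma markov_complement (E : pred {set {set T}}) (G : {set {set T}} -> R) :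
  (forall S, 0 <= G S) ->
  (forall S : {set {set T}}, S \subset F -> ~~ E (subcomplex_with k S) -> 1 <= G S) ->
  1 - random_subcomplex_prob k p E <= expectation F p G.
Proof.
move=> G0 G1; have w0 S : 0 <= weight F p S by apply: weight_ge0 => //; exact: ltW.
rewrite -[X in X - _](random_subcomplex_probT k n p) /random_subcomplex_prob.
rewrite !big_mkcondr /= -sumrB; apply: ler_sum => S; rewrite powersetE => SF.
case: ifPn => ES; first by rewrite subrr mulr_ge0 //; exact: w0.
by rewrite subr0 ler_peMr //; [exact: w0|exact: G1].
Qed.

Let y : R := expR (- (eps ^+ 2 * p * (n - k.+1)%:R / (k.+2)%:R)).

(* By [cross_faces_expansion], supports of cochains of minimal norm are [dense]. *)
Let dense (B : {set {set T}}) :=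
  (B != set0) && (2 * (n - k.+1) * #|B| <= k.+2 * #|cross_coboundary k.+1 B|)%N.

(** At least 1 exactly when at most [(1 - eps) * p * #|cross_coboundary k.+1 B|] faces of the
    coboundary are chosen. *)
Let lower_term B (S : {set {set T}}) : R :=
  expR (eps * ((1 - eps) * p * #|cross_coboundary k.+1 B|%:R
               - #|cross_coboundary k.+1 B :&: S|%:R)).

Let upper_term s (S : {set {set T}}) : R :=
  expR (#|upper s :&: S|%:R - expR 1 * p * #|upper s|%:R).

(** If [G S < 1], every term is below 1 and all failures are excluded at once; Markov's inequality
    for [G] thus performs the union bound. *)
Let G S : R := \sum_(B in powerset (Qfaces k.+1) | dense B) lower_term B S
  + \sum_(s in Qfaces k.+1) upper_term s S.

Let cobF B : cross_coboundary k.+1 B \subset F.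
Proof. by apply/subsetP => t; rewrite in_set => /andP[]. Qed.

Let upperF s : upper s \subset F.
Proof. by apply/subsetP => t; rewrite in_set => /andP[]. Qed.

(** Density bounds the coboundary below by [2 (n - k - 1) #|B| / (k + 2)], whose factor 2 absorbs
    the one in the Chernoff exponent [eps^2 / 2]. *)
Let expected_lower B : dense B -> expectation F p (lower_term B) <= y ^+ #|B|.
Proof.
case/andP => _ dB; apply: (le_trans (chernoff_lower (ltW p0) p1 (cobF B) (ltW eps0))).
rewrite /y -expRM_natr ler_expR mulNr lerN2.
rewrite mulrAC ler_pdivrMr ?ltr0n //.
have := dB; rewrite -(ler_nat R) !natrM => H.
have := ler_wpM2l (mulr_ge0 (sqr_ge0 eps) (ltW p0)) H; lra.
Qed.

Let expected_upper s : s \in Qfaces k.+1 -> expectation F p (upper_term s) <= y.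
Proof.
move=> sQ; apply: le_trans (chernoff_upper (ltW p0) (upperF s)) _.
rewrite ler_expR lerN2 card_upper_faces // natrM.
rewrite ler_pdivrMr ?ltr0n //.
rewrite [leRHS](_ : _ = 2 * k.+2%:R * (p * (n - k.+1)%:R)); last by ring.
rewrite -mulrA ler_wpM2r ?mulr_ge0 ?(ltW p0) //.
(* The exponents compare because [eps^2 <= 1 <= 2 (k + 2)]. *)
apply: (@le_trans _ _ 1); first by rewrite expr_le1 ?ltW.
by rewrite -natrM ler1n.
Qed.

Let expectation_G :
  expectation F p G <= (y + 1) ^+ #|Qfaces k.+1| - 1 + #|Qfaces k.+1|%:R * y.
Proof.
rewrite /expectation /G; under eq_bigr do rewrite mulrDr !mulr_sumr.
rewrite big_split /= [X in X + _]exchange_big [X in _ + X]exchange_big /=.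
apply: lerD; last first.
  by rewrite mulr_natl -sumr_const; apply: ler_sum => s; exact: expected_upper.
(* The subtracted 1 is the term of the empty support, which [dense] excludes. *)
rewrite -sum_powerset_expr [X in X - 1](bigD1 set0) ?powersetE ?sub0set //=.
rewrite cards0 expr0 [leRHS]addrC addKr !big_mkcondr /=; apply: ler_sum => B _.
case: ifP => [dB|_]; last by case: ifP => // _; rewrite exprn_ge0 ?expR_ge0.
by case/andP: (dB) => -> _; exact: expected_lower.
Qed.

(** Each of the desired properties follows from the same bounds on expansion and degree, so one
    estimate serves for every such [E]. *)
Lemma failure_prob (E : pred {set {set T}})
    (c := 2 * (1 - eps) * (n%:R - k%:R - 1) * p / (k%:R + 2))
    (u := (2 * n%:R) ^+ k.+1 * y) :
  (forall V : {set {set T}}, c <= coboundary_expansion R V k ->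
     c <= (max_degree V k)%:R <= expR 1 * p * M -> E V) ->
  1 - random_subcomplex_prob k p E <= expR u - 1 + u.
Proof.
move=> HE.
have cE : c = (1 - eps) * p * M / k.+2%:R.
  rewrite /c /M natrM natrB ?(ltnW kn) // -(natr1 k) opprD addrA.
  have -> : k.+2%:R = k%:R + 2 :> R by rewrite -natrD addn2.
  by congr (_ / _); ring.
have c0 : 0 < c.
  rewrite cE divr_gt0 ?ltr0n // mulr_gt0 ?mulr_gt0 ?subr_gt0 // ltr0n.
  by rewrite muln_gt0 subn_gt0.
apply: le_trans (@markov_complement E G _ _) _.
- by move=> S; rewrite addr_ge0 // sumr_ge0 // => *; exact: expR_ge0.
- move=> S SF; apply: contraR; rewrite -ltNge => GS.
  have expanding (B : {set {set T}}) : B \subset Qfaces k.+1 -> B != set0 ->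
      (2 * (n - k.+1) * #|B| <= k.+2 * #|cross_coboundary k.+1 B|)%N ->
      c * #|B|%:R <= #|cross_coboundary k.+1 B :&: S|%:R.
    move=> BQ B0 dB.
    have : lower_term B S < 1.
      apply: le_lt_trans GS; rewrite /G -[leLHS]addr0 lerD //.
        apply: (@le_term_sum _ _ _ (fun B => lower_term B S)) => [|B' _].
          by rewrite powersetE BQ /dense B0.
        exact: expR_ge0.
      by apply: sumr_ge0 => s _; exact: expR_ge0.
    rewrite expR_lt1 pmulr_rlt0 // subr_lt0 => /ltW; apply: le_trans.
    (* Density of [B] converts a proportion of its coboundary into the multiple [c] of [#|B|]. *)
    rewrite cE mulrAC ler_pdivrMr ?ltr0n // -!mulrA.
    apply: ler_wpM2l; first by rewrite subr_ge0 ltW.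
    apply: ler_wpM2l; first exact: ltW.
    by rewrite -!natrM ler_nat [leqRHS]mulnC.
  apply: HE; first exact: expanding_coboundary_expansion.
  rewrite expanding_max_degree //= /max_degree.
  apply: (big_ind (fun d : nat => d%:R <= expR 1 * p * M)) => [|d d' dM d'M|s].
  + by rewrite !mulr_ge0 ?expR_ge0 ?(ltW p0).
  + by rewrite /maxn; case: ifP.
  rewrite faces_subcomplex_low faces_subcomplex_top // => sQ.
  rewrite (_ : [set t in S | s \subset t] = upper s :&: S); last first.
    apply/setP => t; rewrite in_setI [t \in upper s]in_set.
    rewrite [t \in [set _ in S | _]]in_set; have [tS|] := boolP (t \in S); last by rewrite andbF.
    by rewrite (subsetP SF) // andbT.
  have : upper_term s S < 1.
    apply: le_lt_trans GS; rewrite /G -[leLHS]add0r lerD //.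
      by apply: sumr_ge0 => B _; exact: expR_ge0.
    apply: (@le_term_sum _ _ _ (fun s => upper_term s S)) => [//|s' _].
    exact: expR_ge0.
  by rewrite expR_lt1 subr_lt0 {2}/upper card_upper_faces // => /ltW.
- apply: le_trans expectation_G _.
  have Nu : #|Qfaces k.+1|%:R * y <= u.
    rewrite ler_wpM2r ?expR_ge0 // -natrM -natrX ler_nat.
    exact: card_faces_crosspolytope.
  rewrite lerD // lerD //.
  apply: (@le_trans _ _ (expR y ^+ #|Qfaces k.+1|)).
    by rewrite lerXn2r ?nnegrE ?addr_ge0 ?expR_ge0 // addrC expR_ge1Dx.
  by rewrite -expRM_natl ler_expR.
Qed.
End Failure.

(** * Asymptotics *)

Local Open Scope classical_set_scope.
Local Open Scope ring_scope.

(** From [k + 2 <= n] follows [n / (k + 2) <= 2 (n - k - 1)]; the second factor [k + 2] is the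
    denominator of the expansion bound. *)
Lemma order_lower_bound (R : realFieldType) (k n : nat) (eps p : R) :
  eps < 1 -> (k.+1 < n)%N -> 0 < p ->
  (1 - eps) / k.+2%:R ^+ 2 * (n%:R * p) <=
  2 * (1 - eps) * (n%:R - k%:R - 1) * p / (k%:R + 2).
Proof.
move=> eps1 kn p0.
have -> : k%:R + 2 = k.+2%:R :> R by rewrite -natrD addn2.
have -> : n%:R - k%:R - 1 = (n - k.+1)%:R :> R.
  by rewrite natrB ?(ltnW kn) // -(natr1 k) opprD addrA.
have H : n%:R / k.+2%:R <= 2 * (n - k.+1)%:R :> R.
  rewrite ler_pdivrMr ?ltr0n // -!natrM ler_nat; nia.
rewrite -subr_ge0 (_ : _ - _ = (1 - eps) * p / k.+2%:R * (2 * (n - k.+1)%:R - n%:R / k.+2%:R)).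
  by rewrite mulr_ge0 ?subr_ge0 // mulr_ge0 ?invr_ge0 ?ler0n // mulr_ge0 ?subr_ge0 ?ltW.
have : k.+2%:R != 0 :> R by rewrite pnatr_eq0.
by move: k.+2%:R => K K0; field.
Qed.

Section Asymptotics.
Variables (R : realType) (k : nat) (eps : R).
Hypotheses (eps0 : 0 < eps) (eps1 : eps < 1).
Variables omega p : nat -> R.
Hypothesis omegay : omega @ \oo --> +oo.
Hypothesis hp : forall n : nat, (k.+1 < n)%N ->
  [/\ 0 <= p n, p n <= 1 &
      p n >= ((k%:R + 2) * (k%:R + 1) * ln n%:R + omega n)
               / (eps ^+ 2 * (n%:R - k%:R - 1))].

Let v n : R := 2 ^+ k.+1 * expR (- (omega n / k.+2%:R)).

Lemma failure_bound_cvg0 : expR (v n) - 1 + v n @[n --> \oo] --> (0 : R).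
Proof.
have v0 : v @ \oo --> (0 : R).
  rewrite -[X in _ --> X](mulr0 (2 ^+ k.+1)); rewrite /v; apply: cvgM; first exact: cvg_cst.
  have H : omega n / k.+2%:R @[n --> \oo] --> +oo.
    apply/cvgryPgt => A; move/cvgryPgt : omegay => /(_ (A * k.+2%:R)).
    by apply: filterS => n; rewrite ltr_pdivlMr ?ltr0n.
  exact: (cvg_comp _ (fun x => expR (- x)) H (@cvgr_expR R)).
rewrite -[X in _ --> X](addr0 0) -[X in _ --> X + _](subrr 1).
apply: cvgD => //; apply: cvgB; last exact: cvg_cst.
rewrite -[X in _ --> X]expR0; apply: continuous_cvg v0.
exact: continuous_expR.
Qed.

Lemma density_lower_bound n : (k.+1 < n)%N ->
  k.+2%:R * k.+1%:R * ln n%:R + omega n <= eps ^+ 2 * p n * (n - k.+1)%:R.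
Proof.
move=> kn; have [_ _] := hp kn.
have -> : n%:R - k%:R - 1 = (n - k.+1)%:R :> R.
  by rewrite natrB ?(ltnW kn) // -(natr1 k) opprD addrA.
rewrite ler_pdivrMr; last by rewrite mulr_gt0 ?exprn_gt0 // ltr0n subn_gt0.
have -> : k%:R + 2 = k.+2%:R :> R by rewrite -natrD addn2.
have -> : k%:R + 1 = k.+1%:R :> R by rewrite natr1.
by move=> /le_trans; apply; rewrite mulrCA mulrA.
Qed.

Lemma density_gt0 n : (k.+1 < n)%N -> 0 < omega n -> 0 < p n.
Proof.
move=> kn w0; have [p0 _ _] := hp kn.
rewrite lt0r p0 andbT; apply: contraTneq (density_lower_bound kn) => ->.
rewrite mulr0 mul0r -ltNge ltr_wpDl // !mulr_ge0 // ln_ge0 // ler1n.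
exact: leq_ltn_trans kn.
Qed.

(** Writing [n^(k+1)] as [expR ((k + 1) ln n)], the logarithmic term of the lower bound on [p]
    cancels it and leaves only [omega]. *)
Lemma union_bound_le n : (k.+1 < n)%N ->
  (2 * n%:R) ^+ k.+1 * expR (- (eps ^+ 2 * p n * (n - k.+1)%:R / (k.+2)%:R)) <= v n.
Proof.
move=> kn; have n0 : 0 < n%:R :> R by rewrite ltr0n (leq_ltn_trans _ kn).
rewrite /v exprMn -[leLHS]mulrA; apply: ler_wpM2l; first by rewrite exprn_ge0.
rewrite -[X in X ^+ _](@lnK R n%:R) ?posrE // -expRM_natl -expRD ler_expR.
have := density_lower_bound kn.
rewrite -(@ler_pM2r _ k.+2%:R^-1) ?invr_gt0 ?ltr0n // mulrDl.
rewrite (_ : _ * _ / _ = k.+1%:R * ln n%:R); last first.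
  by rewrite mulrC !mulrA mulVf ?mul1r // pnatr_eq0.
by rewrite lerBlDr (addrC (- _)) lerBrDr.
Qed.

(** The probability is squeezed between 1 minus the failure bound and 1; for large [n],
    [omega n > 0] ensures [0 < p n]. *)
Lemma aas_of_expansion (E : forall n, pred {set {set cross_vertex n}}) :
  (forall n (V : {set {set cross_vertex n}}), (k.+1 < n)%N -> 0 < p n ->
     let c := 2 * (1 - eps) * (n%:R - k%:R - 1) * p n / (k%:R + 2) in
     c <= coboundary_expansion R V k ->
     c <= (max_degree V k)%:R <= expR 1 * p n * (2 * (n - k.+1))%:R ->
     E n V) ->
  aas k p E.
Proof.
move=> HE; rewrite /aas.
apply: (@squeeze_cvgr _ _ _ _ (fun n => 1 - (expR (v n) - 1 + v n)) (fun=> 1)).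
- near=> n.
  have kn : (k.+1 < n)%N by near: n; exact: nbhs_infty_gt.
  have w0 : 0 < omega n by near: n; move/cvgryPgt : omegay; exact.
  have p0 := density_gt0 kn w0; have [_ p1 _] := hp kn.
  rewrite random_subcomplex_prob_le1 // andbT lerBlDr -lerBlDl.
  apply: le_trans (failure_prob kn p0 p1 eps0 eps1 (fun V => HE n V kn p0)) _.
  have := union_bound_le kn; set u := _ * expR _ => uv.
  by rewrite lerD // lerD // ler_expR.
- rewrite -[X in _ --> X]subr0; apply: cvgB; first exact: cvg_cst.
  exact: failure_bound_cvg0.
- exact: cvg_cst.
Unshelve. all: by end_near. Qed.

End Asymptotics.

Theorem corollary5p7 (R : realType) (k : nat) (eps : R)
    (heps0 : 0 < eps) (heps1 : eps < 1) :
  exists C1 C2 c : R, [/\ 0 < C1, 0 < C2, 0 < c &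
    forall (omega p : nat -> R),
      omega @ \oo --> +oo ->
      (forall n : nat, (k.+1 < n)%N ->
         [/\ 0 <= p n, p n <= 1 &
             p n >= ((k%:R + 2) * (k%:R + 1) * ln n%:R + omega n)
                      / (eps ^+ 2 * (n%:R - k%:R - 1))]) ->
      [/\ aas k p (fun n V =>
            coboundary_expansion R V k
              >= 2 * (1 - eps) * (n%:R - k%:R - 1) * p n / (k%:R + 2)),
          aas k p (fun n V =>
            C1 * (n%:R * p n) <= (max_degree V k)%:R <= C2 * (n%:R * p n)) &
          aas k p (fun n V =>
            coboundary_expansion R V k / (max_degree V k)%:R >= c)]].
Proof.
(* [C1] comes from [order_lower_bound] and serves for both expansion and degree. [C2] comes from the
   degree bound [e p] times [2 (n - k - 1)], and the quotient is then at least [C1 / C2]. *)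
pose C1 : R := (1 - eps) / k.+2%:R ^+ 2; pose C2 : R := 2 * expR 1.
have C1_gt0 : 0 < C1 by rewrite divr_gt0 ?subr_gt0 // exprn_gt0 // ltr0n.
have C2_gt0 : 0 < C2 by rewrite mulr_gt0 ?expR_gt0.
exists C1, C2, (C1 / C2); split=> //; first by rewrite divr_gt0.
move=> omega p omegay hp.
have upper n : (k.+1 < n)%N -> 0 < p n ->
    expR 1 * p n * (2 * (n - k.+1))%:R <= C2 * (n%:R * p n).
  move=> kn p0; rewrite /C2 natrM.
  rewrite (_ : _ * (2 * _) = 2 * expR 1 * ((n - k.+1)%:R * p n)); last by ring.
  apply: ler_wpM2l; first by rewrite mulr_ge0 ?expR_ge0.
  by apply: ler_wpM2r; [exact: ltW | rewrite ler_nat leq_subr].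
split; apply: (aas_of_expansion heps0 heps1 omegay hp) => n V kn p0 c ch /andP[cD De].
- exact: ch.
- rewrite (le_trans _ cD) ?order_lower_bound //=.
  by apply: le_trans De _; exact: upper.
- have np0 : 0 < n%:R * p n by rewrite mulr_gt0 // ltr0n (leq_ltn_trans _ kn).
  have C1c := order_lower_bound heps1 kn p0.
  have D0 : 0 < (max_degree V k)%:R :> R.
    by apply: lt_le_trans cD; apply: lt_le_trans C1c; rewrite mulr_gt0.
  rewrite ler_pdivlMr // (le_trans _ ch) // (le_trans _ C1c) //.
  rewrite -[leLHS]mulrA; apply: ler_wpM2l; first exact: ltW.
  rewrite mulrC ler_pdivrMr // mulrC.
  by apply: le_trans De _; exact: upper.
Qed.
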